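(* For all integers $n \geq 1$ and $k \geq 0$, \[ \mathscr{I}(P_n) \cong \begin{cases} K_1 & \text{if } n = 3k,\\ \mathfrak{L}_k & \text{if } n = 3k+1,\\ P_{k+2} & \text{if } n = 3k+2. \end{cases} \]
   Context: For a graph $G$, an independent dominating set is a set of vertices that is both independent and dominating; $i(G)$ is the minimum size of an independent dominating set, and an $i$-set of $G$ is an independent dominating set of size $i(G)$. The $i$-graph $\mathscr{I}(G)$ of $G$ has the $i$-sets of $G$ as its vertices, and two $i$-sets $X,Y$ are adjacent if and only if there is an edge $xy \in E(G)$ with $x \in X$, $y\notin X$ and $Y = (X \setminus \{x\}) \cup \{y\}$ (a ''token slide'' along an edge). $P_n$ denotes the path on $n$ vertices. For $k \geq 0$ the worn $k$-lattice graph $\mathfrak{L}_k$ has vertex set $\{w_{i,j} : 0 \le j \le i \le k\}$ (so $\binom{k+2}{2}$ vertices), and $w_{a,b}$ is adjacent to $w_{c,d}$ if and only if either ($a = c-1$ and $b \in \{d, d-1\}$) or ($a = c+1$ and $b \in \{d, d+1\}$). *)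

(* Defs.v *)
From mathcomp Require Import all_boot.

Set Implicit Arguments.
Unset Strict Implicit.
Unset Printing Implicit Defensive.

Record sgraph := SGraph {
  vertex :> finType;
  adj : rel vertex;
  adj_sym : symmetric adj;
  adj_irrefl : irreflexive adj
}.

Definition graph_iso (G H : sgraph) : Prop :=
  exists2 f : G -> H, bijective f & forall x y : G, adj (f x) (f y) = adj x y.

Notation "G ≅ H" := (graph_iso G H) (at level 70, no associativity).

Section IndependentDomination.
Variable G : sgraph.
Implicit Types X Y : {set G}.

Definition independent X : bool := [forall x in X, forall y in X, ~~ adj x y].

Definition dominating X : bool :=
  [forall v, (v \in X) || [exists x in X, adj x v]].

Definition indep_dominating X : bool := independent X && dominating X.

Lemma indep_dominating_exists : exists m, [exists X, indep_dominating X && (#|X| == m)].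
Proof.
have [|X /maxsetP[indX maxX] _] := @maxset_exists G independent set0.
  by apply/forall_inP=> x; rewrite inE.
exists #|X|; apply/existsP; exists X; rewrite eqxx andbT /indep_dominating indX.
apply/forallP=> v; case: (boolP (v \in X)) => //= vX.
apply: contraNT vX => /existsPn nadj.
have nadjv x : x \in X -> adj x v = false.
  by move=> xX; have := nadj x; rewrite xX => /negbTE.
rewrite -(maxX (v |: X)) ?setU11 ?subsetUr //.
apply/forall_inP=> x; rewrite !inE => /predU1P[->|xX]; apply/forall_inP=> y;
  rewrite !inE => /predU1P[->|yX].
- by rewrite adj_irrefl.
- by rewrite adj_sym nadjv.
- by rewrite nadjv.
by move/forall_inP: indX => /(_ x xX) /forall_inP; apply.
Qed.

Definition indep_dom_number : nat := ex_minn indep_dominating_exists.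

Definition is_iset X : bool := indep_dominating X && (#|X| == indep_dom_number).

Definition token_slide X Y : bool :=
  [exists x, exists y,
    [&& adj x y, x \in X, y \notin X & Y == y |: (X :\ x)]].

Lemma token_slide_sym : symmetric token_slide.
Proof.
suff H X Y : token_slide X Y -> token_slide Y X.
  by move=> X Y; apply/idP/idP; apply: H.
case/existsP=> x /existsP[y /and4P[xy xX yX /eqP->]].
have nxy : x != y by apply: contraNneq yX => <-.
apply/existsP; exists y; apply/existsP; exists x.
rewrite adj_sym xy !inE !eqxx (negbTE nxy) /=; apply/eqP; apply/setP=> z; rewrite !inE.
have [->|_] := eqVneq z x; first by rewrite xX.
by have [->|] := eqVneq z y; first by rewrite (negbTE yX).
Qed.

Lemma token_slide_irrefl : irreflexive token_slide.
Proof.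
move=> X; apply/negbTE/negP=> /existsP[x /existsP[y /and4P[_ _ yX /eqP XE]]].
by move: yX; rewrite XE setU11.
Qed.

Definition iset := {X : {set G} | is_iset X}.

Definition iset_adj : rel iset := fun A B => token_slide (val A) (val B).

Lemma iset_adj_sym : symmetric iset_adj.
Proof. by move=> A B; apply: token_slide_sym. Qed.

Lemma iset_adj_irrefl : irreflexive iset_adj.
Proof. by move=> A; apply: token_slide_irrefl. Qed.

Definition igraph : sgraph := SGraph iset_adj_sym iset_adj_irrefl.

End IndependentDomination.

Section Path.
Variable n : nat.

Definition path_adj : rel 'I_n := fun i j => (i.+1 == j) || (j.+1 == i).

Lemma path_adj_sym : symmetric path_adj.
Proof. by move=> i j; rewrite /path_adj orbC. Qed.

Lemma path_adj_irrefl : irreflexive path_adj.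
Proof. by move=> i; rewrite /path_adj orbb eqn_leq ltnn. Qed.

Definition path_graph : sgraph := SGraph path_adj_sym path_adj_irrefl.

End Path.

Section Complete.
Variable n : nat.

Definition complete_adj : rel 'I_n := fun i j => i != j.

Lemma complete_adj_sym : symmetric complete_adj.
Proof. by move=> i j; rewrite /complete_adj eq_sym. Qed.

Lemma complete_adj_irrefl : irreflexive complete_adj.
Proof. by move=> i; rewrite /complete_adj eqxx. Qed.

Definition complete_graph : sgraph := SGraph complete_adj_sym complete_adj_irrefl.

End Complete.

Section WornLattice.
Variable k : nat.

(* The vertex w_{i,j} is the pair (i, j); subtraction-free form of the
   adjacency rule: a = c - 1 is written a.+1 = c, and so on. *)
Definition worn_vertex := {w : 'I_k.+1 * 'I_k.+1 | w.2 <= w.1}.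

Definition worn_adj : rel worn_vertex := fun u v =>
  let: (a, b) := val u in let: (c, d) := val v in
  ((a.+1 == c) && ((b == d) || (b.+1 == d)))
  || ((a == c.+1 :> nat) && ((b == d) || (b == d.+1 :> nat))).

Lemma worn_adj_sym : symmetric worn_adj.
Proof.
move=> u v; rewrite /worn_adj; case: (val u) (val v) => [a b] [c d].
by rewrite orbC (eq_sym b d) (eq_sym (c.+1) a) (eq_sym (a.+1) c)
  (eq_sym (d.+1) b) (eq_sym (b.+1) d).
Qed.

Lemma worn_adj_irrefl : irreflexive worn_adj.
Proof.
move=> u; rewrite /worn_adj; case: (val u) => [a b].
by rewrite (eq_sym (a : nat)) !eqn_leq !ltnn.
Qed.

Definition worn_lattice : sgraph := SGraph worn_adj_sym worn_adj_irrefl.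

End WornLattice.

(* Main.v *)
(* A set {p_1 < ... < p_m} of vertices of P_n = {0, ..., n-1} is independent and
   dominating iff, after adding the virtual elements p_0 = -2 and p_{m+1} = n+1,
   all m+1 gaps have length 2 or 3.  The gaps sum to n+3, so exactly 3m-n of
   them have length 2: the size m is least when r = 3m-n is at most 2, and an
   i-set is then the choice of r short gaps among m+1.  Sliding a token of the
   i-set exchanges two consecutive gaps of different lengths, so I(P_n) is the
   graph of r tokens sliding on P_{m+1}, which is K_1, P_{m+1} or a worn
   lattice for r = 0, 1, 2. *)
Require Import Defs.
From mathcomp Require Import all_boot.
From mathcomp Require Import zify.

Set Implicit Arguments.
Unset Strict Implicit.
Unset Printing Implicit Defensive.

(** * Bijections of finite types and composition of graph isomorphisms *)

Lemma inj_surj_bij (A B : finType) (f : A -> B) :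
  injective f -> (forall y, exists x, f x = y) -> bijective f.
Proof.
move=> f_inj f_surj.
have f_surjb y : exists x, f x == y by have [x <-] := f_surj y; exists x.
have gK : cancel (fun y => xchoose (f_surjb y)) f.
  by move=> y; apply/eqP/(xchooseP (f_surjb y)).
by exists (fun y => xchoose (f_surjb y)) => // x; apply: f_inj; rewrite gK.
Qed.

Lemma graph_iso_sym (G H : sgraph) : G ≅ H -> H ≅ G.
Proof.
case=> f [g fK gK] f_adj; exists g; first by exists f.
by move=> x y; rewrite -f_adj !gK.
Qed.

Lemma graph_iso_trans (G H K : sgraph) : G ≅ H -> H ≅ K -> G ≅ K.
Proof.
case=> f f_bij f_adj [g g_bij g_adj]; exists (g \o f); first exact: bij_comp.
by move=> x y; rewrite /= g_adj f_adj.
Qed.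

(** * Token graphs with zero, one and two tokens *)

Section TokenGraph.
Variables (G : sgraph) (r : nat).

Definition token_vertex := {D : {set G} | #|D| == r}.

Definition token_adj : rel token_vertex := fun A B => token_slide (val A) (val B).

Lemma token_adj_sym : symmetric token_adj.
Proof. by move=> A B; apply: token_slide_sym. Qed.

Lemma token_adj_irrefl : irreflexive token_adj.
Proof. by move=> A; apply: token_slide_irrefl. Qed.

Definition token_graph : sgraph := SGraph token_adj_sym token_adj_irrefl.

End TokenGraph.

Lemma token_graph0 (G : sgraph) : token_graph G 0 ≅ complete_graph 1.
Proof.
have all_eq (A B : token_graph G 0) : A = B.
  apply: val_inj; have /eqP := valP B; have /eqP := valP A.
  by move=> /cards0_eq-> /cards0_eq->.
have card0 : #|set0 : {set G}| == 0 by rewrite cards0.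
exists (fun=> ord0).
  exists (fun=> exist _ set0 card0 : token_graph G 0) => [A|i]; first exact: all_eq.
  by rewrite (ord1 i).
by move=> A B; rewrite (all_eq A B) !adj_irrefl.
Qed.

Lemma token_slide_set1 (G : sgraph) (x y : G) :
  token_slide [set x] [set y] = adj x y.
Proof.
apply/existsP/idP => [[a /existsP[b /and4P[ab]]]|xy].
  rewrite inE => /eqP ax _ /eqP E; move: ab; rewrite ax.
  by have : b \in [set y] by [rewrite E setU11]; rewrite inE => /eqP->.
exists x; apply/existsP; exists y; rewrite xy !inE eqxx /=.
have nyx : y != x by apply: contraTneq xy => ->; rewrite adj_irrefl.
by rewrite nyx setDv setU0 eqxx.
Qed.

Lemma token_graph1 (G : sgraph) : token_graph G 1 ≅ G.
Proof.
apply: graph_iso_sym.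
pose f (x : G) : token_graph G 1 := exist _ [set x] (introT eqP (cards1 x)).
exists f; last by move=> x y; apply: token_slide_set1.
apply: inj_surj_bij => [x y /(congr1 val) /set1_inj //|[D D1]].
by have /cards1P[x Dx] := D1; exists x; apply: val_inj.
Qed.

(** Tokens on a path cannot overtake one another: a slide keeps the order of the pair, so one
    coordinate is fixed and the other moves along an edge. *)
Lemma path_slide_set2 n (s t s' t' : 'I_n) : s < t -> s' < t' ->
  @token_slide (path_graph n) [set s; t] [set s'; t'] =
  [|| (s == s') && path_adj t t' | (t == t') && path_adj s s'].
Proof.
move=> st st'; apply/existsP/idP => [[x /existsP[y /and4P[]]]|].
  move=> xy xst yst /eqP/setP E.
  have ins : (s \in [set s'; t']) = (s != x).
    rewrite (E s) !inE eqxx andbT orb_idl //.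
    by move/eqP=> sy; move: yst; rewrite -sy !inE eqxx.
  have int : (t \in [set s'; t']) = (t != x).
    rewrite (E t) !inE eqxx orbT andbT orb_idl //.
    by move/eqP=> ty; move: yst; rewrite -ty !inE eqxx orbT.
  have iny : y \in [set s'; t'] by rewrite (E y) setU11.
  move: xst yst ins int iny xy; rewrite !inE /= /path_adj -!(inj_eq val_inj) /=.
  move=> {E} /orP[] /eqP xE; rewrite xE {x xE}.
    move=> yst _ int iny; have {}int : (t == s' :> nat) || (t == t' :> nat) by lia.
    by case/orP: int => /eqP tE; case/orP: iny => /eqP yE; lia.
  move=> yst ins _ iny; have {}ins : (s == s' :> nat) || (s == t' :> nat) by lia.
  by case/orP: ins => /eqP sE; case/orP: iny => /eqP yE; lia.
have set2_slide (a b c : 'I_n) : a != c :> nat -> a != b :> nat -> b != c :> nat ->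
    [set a; c] = c |: ([set a; b] :\ b).
  rewrite !(inj_eq val_inj) => ac ab bc; apply/setP=> z; rewrite !inE.
  have [->|] := eqVneq z b; last by rewrite orbF orbC.
  by rewrite (negbTE bc) eq_sym (negbTE ab).
case/orP=> /andP[/eqP E]; rewrite /path_adj => a.
  exists t; apply/existsP; exists t'; move: st'; rewrite -E => st'.
  rewrite -set2_slide; try lia.
  by rewrite /= /path_adj a !inE !eqxx -!(inj_eq val_inj) /=; lia.
exists s; apply/existsP; exists s'; move: st'; rewrite -E => st'.
rewrite [[set s; t]]setUC [[set s'; t]]setUC.
rewrite -set2_slide; try lia.
by rewrite /= /path_adj a !inE !eqxx -!(inj_eq val_inj) /=; lia.
Qed.

(* The vertex w_{i,j} corresponds to tokens at [j] and [k + 1 - (i - j)]: the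
   index [i] counts the empty places left of the first token and right of the
   second one, and [j] those on the left. *)
Lemma token_graph2_path k : token_graph (path_graph k.+2) 2 ≅ worn_lattice k.
Proof.
apply: graph_iso_sym.
pose s (w : worn_vertex k) : 'I_k.+2 := inord (val w).2.
pose t (w : worn_vertex k) : 'I_k.+2 := inord (k.+1 + (val w).2 - (val w).1).
have wP (w : worn_vertex k) : (val w).2 <= (val w).1 <= k.
  by have := ltn_ord (val w).1; have := valP w; rewrite /=; lia.
have sE w : s w = (val w).2 :> nat by rewrite inordK //; have := wP w; lia.
have tE w : t w = k.+1 + (val w).2 - (val w).1 :> nat.
  by rewrite inordK //; have := wP w; lia.
have st w : s w < t w by rewrite sE tE; have := wP w; lia.
have card2 w : #|[set s w; t w]| == 2.
  by rewrite cards2 -(inj_eq val_inj) /=; have := st w; lia.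
pose f (w : worn_lattice k) : token_graph (path_graph k.+2) 2 :=
  exist (fun D : {set path_graph k.+2} => #|D| == 2) _ (card2 w).
exists f.
  apply: inj_surj_bij => [u v /(congr1 val) /= /setP E|[D D2]].
    (* These memberships match the two pairs only as sets; the bounds [hu] and [hv] order each pair
       and so decide which token is which. *)
    have := (E (s u), E (t u), E (s v), E (t v)); rewrite !inE -!(inj_eq val_inj) /=.
    have := (wP u, wP v); rewrite !sE !tE => -[hu hv] [[[e1 e2] e3] e4].
    apply: val_inj; case: u v {E f card2 st tE sE wP s t} hu hv e1 e2 e3 e4 => [[i j] /= ji] [[i' j'] /= ji'].
    by move=> *; congr pair; apply: val_inj => /=; lia.
  have /cards2P[x [y [nxy Dxy]]] := D2.
  wlog xy : x y nxy Dxy / x < y.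
    move=> wl; move: (nxy); rewrite -(inj_eq val_inj) neq_ltn => /orP[|] h.
      exact: (wl x y).
    by apply: (wl y x) => //; rewrite ?(eq_sym y) // setUC.
  have xk := ltn_ord x; have yk := ltn_ord y.
  have hi : x + (k.+1 - y) < k.+1 by lia.
  have hj : x < k.+1 by lia.
  have ji : Ordinal hj <= Ordinal hi by rewrite /=; lia.
  exists (exist _ (Ordinal hi, Ordinal hj) ji); apply: val_inj; rewrite /= Dxy.
  congr [set _; _]; apply: val_inj; rewrite /= ?sE ?tE /=; lia.
move=> u v; rewrite /= /token_adj /= path_slide_set2 // /path_adj.
rewrite -!(inj_eq val_inj) /= !sE !tE /worn_adj.
case: u v => [[i j] /= ji] [[i' j'] /= ji'].
rewrite -!(inj_eq val_inj) /=.
have := (ltn_ord i, ltn_ord i'); move=> [hi hi']; lia.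
Qed.

(** * Words of gaps of length 2 or 3 and their partial sums *)

Section GapWords.
Implicit Types P Q : nat -> bool.

(** [P j] says that gap [j] is short: a boolean counts as 0 or 1, so [3 - P j] is the length of the
    gap. The partial sums are the positions of the elements, counted from the left virtual one. *)
Definition gap_sum P i := \sum_(j < i) (3 - P j).

Definition gap_sums P i := [seq gap_sum P j | j <- iota 0 i].

Lemma gap_sum0 P : gap_sum P 0 = 0.
Proof. exact: big_ord0. Qed.

Lemma gap_sumS P i : gap_sum P i.+1 = gap_sum P i + (3 - P i).
Proof. exact: big_ord_recr. Qed.

Lemma eq_gap_sum P Q M i : (forall j, j < M -> P j = Q j) -> i <= M ->
  gap_sum P i = gap_sum Q i.
Proof. by move=> PQ iM; apply: eq_bigr => j _; rewrite PQ //; have := ltn_ord j; lia. Qed.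

Lemma gap_sum_total P M : gap_sum P M + \sum_(i < M) P i = 3 * M.
Proof.
elim: M => [|M IH]; first by rewrite gap_sum0 big_ord0.
by rewrite gap_sumS big_ord_recr mulnS -IH /=; lia.
Qed.

Lemma gap_sum_ltn P i j : i < j -> gap_sum P i + 2 <= gap_sum P j.
Proof.
elim: j => // j IH; rewrite ltnS leq_eqVlt gap_sumS => /predU1P[->|/IH]; lia.
Qed.

Lemma gap_sum_cases P i j :
  [\/ i = j, i < j /\ gap_sum P i + 2 <= gap_sum P j
    | j < i /\ gap_sum P j + 2 <= gap_sum P i].
Proof.
by case: (ltngtP i j) => h; [constructor 2|constructor 3|constructor 1] => //;
  split=> //; apply: gap_sum_ltn.
Qed.

Lemma gap_sum_locate P M z : z < gap_sum P M ->
  exists2 i, i < M & gap_sum P i <= z < gap_sum P i.+1.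
Proof.
elim: M => [|M IH] zM; first by rewrite gap_sum0 in zM.
have [/IH[i iM iz]|Mz] := ltnP z (gap_sum P M); first by exists i => //; lia.
by exists M => //; rewrite Mz.
Qed.

Lemma gap_sumsP P M z :
  reflect (exists2 i, i < M & z = gap_sum P i) (z \in gap_sums P M).
Proof.
apply: (iffP mapP) => -[i iM ->]; exists i => //.
  by move: iM; rewrite mem_iota.
by rewrite mem_iota.
Qed.

(** A finite set of numbers has only one increasing enumeration. This is how gap sums are recovered
    from the set that they describe. *)
Lemma increasing_same_image (f g : nat -> nat) M :
  (forall i j, i < j -> f i < f j) -> (forall i j, i < j -> g i < g j) ->
  [seq f i | i <- iota 0 M] =i [seq g i | i <- iota 0 M] ->
  forall i, i < M -> f i = g i.
Proof.
move=> f_incr g_incr fg i iM.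
have sorted_map h : (forall i j, i < j -> h i < h j) ->
    sorted ltn [seq h i | i <- iota 0 M].
  by move=> h_incr; apply: homo_sorted (iota_ltn_sorted 0 M) => a b; apply: h_incr.
have E := irr_sorted_eq ltn_trans ltnn (sorted_map f f_incr) (sorted_map g g_incr) fg.
have := congr1 (fun s => nth 0 s i) E.
by rewrite !(nth_map 0) ?size_iota // nth_iota.
Qed.

End GapWords.

(** * Independent dominating sets of a path as gap words *)

Section PathDomination.
Variable n : nat.
Local Notation Pn := (path_graph n).
Implicit Types (X Y : {set Pn}) (P Q : nat -> bool).

(* Vertices are shifted by 2, with two virtual elements -2 and n + 1 added. *)
Definition padded X z :=
  [|| z == 0, z == n + 3 | [exists x in X, z == x + 2]].

(** When the [m.+1] gaps add up to [n + 3], the first and last of the [m.+2] sums are the virtual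
    elements, which leaves [m] vertices. *)
Definition gap_set P m : {set Pn} := [set x : 'I_n | x + 2 \in gap_sums P m.+2].

Lemma paddedP X z :
  reflect [\/ z = 0, z = n + 3 | exists2 x, x \in X & z = x + 2] (padded X z).
Proof.
apply: (iffP or3P) => -[].
- by move/eqP; constructor 1.
- by move/eqP; constructor 2.
- by case/exists_inP=> x xX /eqP; constructor 3; exists x.
- by move/eqP; constructor 1.
- by move/eqP; constructor 2.
- by case=> x xX /eqP zx; constructor 3; apply/exists_inP; exists x.
Qed.

Lemma padded_in X (x : Pn) : padded X (x + 2) = (x \in X).
Proof.
apply/paddedP/idP => [[||[y yX xy]]|xX].
- lia.
- by have := ltn_ord x; lia.
- by rewrite (_ : x = y) //; apply: val_inj => /=; lia.
by constructor 3; exists x.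
Qed.

Lemma gap_setP P m (x : Pn) :
  reflect (exists2 i, i < m.+2 & x + 2 = gap_sum P i) (x \in gap_set P m).
Proof. by rewrite inE; apply: gap_sumsP. Qed.

Lemma padded_gap_set P m : gap_sum P m.+1 = n + 3 ->
  forall z, padded (gap_set P m) z = (z \in gap_sums P m.+2).
Proof.
move=> Pn3 z; apply/paddedP/gap_sumsP => [[->|->|[x /gap_setP[i im xi] ->]]|[i im ->]].
- by exists 0; rewrite ?gap_sum0.
- by exists m.+1; rewrite ?Pn3.
- by exists i.
have [->|i0] := eqVneq i 0; first by constructor 1; rewrite gap_sum0.
have [->|im1] := eqVneq i m.+1; first by constructor 2.
have := @gap_sum_ltn P 0 i; have := @gap_sum_ltn P i m.+1; rewrite Pn3 gap_sum0 => h1 h2.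
have xn : gap_sum P i - 2 < n by lia.
constructor 3; exists (Ordinal xn : Pn); last by rewrite /=; lia.
by apply/gap_setP; exists i => //=; lia.
Qed.

(** Gaps of length at least 2 give independence. Gaps of length at most 3 give domination: anything
    strictly inside a gap is next to one of its ends. *)
Lemma gap_set_indep_dominating P m : gap_sum P m.+1 = n + 3 ->
  indep_dominating (gap_set P m).
Proof.
move=> Pn3; apply/andP; split.
  apply/forall_inP=> x /gap_setP[i im xi]; apply/forall_inP=> y /gap_setP[j jm yj].
  rewrite /= /path_adj.
  by case: (gap_sum_cases P i j) => [ij|[_]|[_]]; first (subst i); lia.
apply/forallP=> v; have vn := ltn_ord v.
have [|i im iv] := @gap_sum_locate P m.+1 (v + 2); first by rewrite Pn3; lia.
have [E|nE] := eqVneq (gap_sum P i) (v + 2).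
  by apply/orP; left; apply/gap_setP; exists i => //; lia.
apply/orP; right.
have adjI (x : nat) : x < n -> padded (gap_set P m) (x + 2) -> (x.+1 == v) || (v.+1 == x) ->
    [exists x in gap_set P m, adj x v].
  move=> xn px xv; apply/exists_inP; exists (Ordinal xn : Pn) => //.
  by rewrite -padded_in.
(* In shifted coordinates [v] sits at [v + 2], so here the left end of the gap is the predecessor of
   [v]. It is not the virtual element, since [v.+1] is positive. *)
have [E1|nE1] := eqVneq (gap_sum P i) v.+1.
  have i0 : i != 0 by apply: contraTneq nE => i0; move: E1; rewrite i0 gap_sum0.
  have := @gap_sum_ltn P 0 i; rewrite gap_sum0 => h.
  apply: (adjI v.-1); try lia.
  by rewrite padded_gap_set //; apply/gap_sumsP; exists i; lia.
(* The left end is now at most [v], so the right end is exactly [v + 3], the successor of [v]; it is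
   below [n + 3] because [v < n]. *)
have iS := gap_sumS P i.
have := @gap_sum_ltn P i.+1 m.+1; rewrite Pn3 => h.
have hn : i.+1 = m.+1 -> gap_sum P i.+1 = n + 3 by move=> ->.
apply: (adjI v.+1); try lia.
by rewrite padded_gap_set //; apply/gap_sumsP; exists i.+1; lia.
Qed.

Lemma card_gap_set P m : gap_sum P m.+1 = n + 3 -> #|gap_set P m| = m.
Proof.
move=> Pn3.
have f2 (i : 'I_m) : 2 <= gap_sum P i.+1.
  by have := @gap_sum_ltn P 0 i.+1 isT; lia.
have fn (i : 'I_m) : gap_sum P i.+1 - 2 < n.
  by have := @gap_sum_ltn P i.+1 m.+1; have := f2 i; have := ltn_ord i; lia.
pose f i : Pn := Ordinal (fn i).
have f_inj : injective f.
  move=> i j /(congr1 val) /= ij; apply: val_inj => /=.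
  have := f2 i; have := f2 j.
  by case: (gap_sum_cases P i.+1 j.+1) => [[]|[_]|[_]]; lia.
suff -> : gap_set P m = f @: [set: 'I_m] by rewrite card_imset // cardsT card_ord.
apply/setP=> x; apply/gap_setP/imsetP => [[i im xi]|[i _ ->]].
  have i0 : i != 0 by apply: contraTneq isT => i0; move: xi; rewrite i0 gap_sum0; lia.
  have im1 : i != m.+1.
    by apply: contraTneq isT => E; move: xi (ltn_ord x); rewrite E Pn3; lia.
  have im' : i.-1 < m by lia.
  exists (Ordinal im') => //; apply: val_inj => /=; rewrite prednK; lia.
by exists i.+1; rewrite /=; have := f2 i; have := ltn_ord i; lia.
Qed.

(** Walk through the padded set from 0: independence excludes a gap of 1 and domination excludes a
    gap above 3, so each step has length 2 or 3. *)
Lemma indep_dominating_gap_set X : indep_dominating X ->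
  exists P m, gap_sum P m.+1 = n + 3 /\ X = gap_set P m.
Proof.
case/andP=> /forall_inP indX /forallP domX.
have padded_le z : padded X z -> z <= n + 3.
  by case/paddedP=> [->|->|[x _ ->]] //; have := ltn_ord x; lia.
have padded_indep z : padded X z -> ~~ padded X z.+1.
  move=> pz; apply/negP; move: pz; case/paddedP=> [->|->|[x xX ->]] /paddedP[]; try lia.
  - by case=> y; lia.
  - by case=> y _; have := ltn_ord y; lia.
  - by have := ltn_ord x; lia.
  case=> y yX xy; have /forall_inP/(_ y yX) := indX x xX.
  by rewrite /= /path_adj; lia.
have padded_next z : padded X z -> z < n + 3 -> padded X (z + 2) || padded X (z + 3).
  (* For [z >= n] the virtual element [n + 3] serves as the next one, and [z = n + 2] would put it
     at distance 1. *)
  move=> pz zn; have [zn'|] := ltnP z n; last first.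
    move=> nz; have : z = n \/ z = n.+1 \/ z = n.+2 by lia.
    case=> [->|[zE|zE]]; first by apply/orP; right; apply/paddedP; constructor 2.
      by apply/orP; left; apply/paddedP; constructor 2; lia.
    case/negP: (@padded_indep z pz); apply/paddedP; constructor 2; lia.
  (* The vertex numbered [z] has shifted position [z + 2]. If it is not in [X], a dominating
     neighbour is at [z + 1], too close to [z], or at [z + 3]. *)
  have /orP[zX|/exists_inP[x xX]] := domX (Ordinal zn' : Pn).
    by rewrite -padded_in /= in zX; rewrite zX.
  rewrite -padded_in in xX; rewrite /= /path_adj /= => /orP[/eqP|/eqP] xz.
    by case/negP: (@padded_indep z pz); move: xX; congr (padded X _); lia.
  by apply/orP; right; move: xX; congr (padded X _); lia.
(* The walk takes a step of 2 when that lands in the padded set and a step of 3 otherwise; [P]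
   records these choices. *)
pose r := fix r i := if i is j.+1 then r j + (3 - padded X (r j + 2)) else 0.
pose P i := padded X (r i + 2).
have rE i : gap_sum P i = r i.
  by elim: i => [|i IH]; rewrite ?gap_sum0 // gap_sumS IH.
have ex_big : exists i, n + 3 <= r i.
  exists (n + 3); rewrite -rE; elim: (n + 3) => // i IH.
  by rewrite gap_sumS; lia.
(* Before the first index [M] at which the walk reaches [n + 3], every position is below [n + 3], so
   [padded_next] applies to it. *)
case: (ex_minnP ex_big) => M rM minM.
have padded_r i : i <= M -> padded X (r i).
  elim: i => [_|i IH iM]; first by apply/paddedP; constructor 1.
  have ri : r i < n + 3 by rewrite ltnNge; apply/negP=> /minM; lia.
  have := padded_next _ (IH (ltnW iM)) ri; rewrite /=.
  by case: (boolP (padded X (r i + 2))).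
have rMn : r M = n + 3 by apply/eqP; rewrite eqn_leq rM andbT padded_le ?padded_r.
case: M rM minM padded_r rMn => [|m] _ minM padded_r rMn; first by move: rMn => /=; lia.
exists P, m; split; first by rewrite rE.
apply/setP=> x; apply/idP/gap_setP => [xX|[i im xi]]; last first.
  by rewrite -padded_in xi rE padded_r.
have xn := ltn_ord x.
(* The walk skips no element of [X]: inside a step, distance 1 contradicts independence, and
   distance 2 would have made the step short. *)
have [|i im] := @gap_sum_locate P m.+1 (x + 2); first by rewrite rE rMn; lia.
rewrite gap_sumS rE => ix; exists i; first by lia.
rewrite rE; rewrite -padded_in in xX.
have [//|nxi] := eqVneq ((x : nat) + 2) (r i).
have [x1|nx1] := eqVneq ((x : nat) + 2) (r i).+1.
  by rewrite x1 in xX; move: xX; rewrite (negbTE (padded_indep _ (padded_r i _))) //; lia.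
have Pi : P i = false by lia.
by move: Pi; rewrite /P (_ : r i + 2 = x + 2) ?xX //; lia.
Qed.

End PathDomination.

(* Stated pointwise so as to be symmetric under reversing the move. *)
Definition slide_up n (X Y : {set 'I_n}) : Prop :=
  exists x y : 'I_n, [/\ y = x.+1 :> nat, x \in X /\ y \notin X,
    x \notin Y /\ y \in Y & forall z, z != x -> z != y -> (z \in X) = (z \in Y)].

(** Each edge of a path points upwards in exactly one direction, so slides need to be compared for
    upward moves only. *)
Lemma token_slide_path n (X Y : {set 'I_n}) :
  reflect (slide_up X Y \/ slide_up Y X) (@token_slide (path_graph n) X Y).
Proof.
have up_slide (A B : {set 'I_n}) : slide_up A B -> @token_slide (path_graph n) A B.
  case=> x [y [yx [xA yA] [xB yB] E]]; apply/existsP; exists x; apply/existsP; exists y.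
  apply/and4P; split=> //; first by rewrite /= /path_adj yx eqxx.
  apply/eqP/setP=> z; rewrite !inE.
  have [->|zy] := eqVneq z y; first by rewrite yB.
  by have [->|zx] := eqVneq z x; rewrite ?(negbTE xB) //= E.
apply: (iffP idP) => [/existsP[x /existsP[y /and4P[xy xX yX /eqP YE]]]|[]]; last first.
- by rewrite token_slide_sym; apply: up_slide.
- exact: up_slide.
have nxy : x != y by apply: contraNneq yX => <-.
have xY : x \notin Y by rewrite YE !inE eqxx (negbTE nxy).
have yY : y \in Y by rewrite YE !inE eqxx.
have E z : z != x -> z != y -> (z \in X) = (z \in Y).
  by move=> zx zy; rewrite YE !inE zx (negbTE zy).
move: xy; rewrite /= /path_adj => /orP[/eqP xy|/eqP yx]; [left|right].
  by exists x, y.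
by exists y, x; split=> // z zy zx; rewrite E.
Qed.

(** * Slides of short gaps against slides of vertices *)

Section GapTokens.
Variables (n m : nat).
Local Notation Pn := (path_graph n).
Implicit Types D E : {set 'I_m.+1}.

(** [inord] extends [D] to all numbers. Its default value beyond [m] is harmless, because sums up to
    index [m.+1] read only the gaps [0] to [m]. *)
Definition short_gap D (j : nat) : bool := inord j \in D.

Definition tokens_to_set D : {set Pn} := gap_set n (short_gap D) m.

Lemma gap_sum_card D : gap_sum (short_gap D) m.+1 + #|D| = 3 * m.+1.
Proof.
rewrite -(gap_sum_total (short_gap D)); congr addn.
rewrite -sum1_card big_mkcond; apply: eq_bigr => i _.
by rewrite /short_gap inord_val; case: (i \in D).
Qed.

Lemma eq_short_gap D E : (forall i, i < m.+2 ->
  gap_sum (short_gap D) i = gap_sum (short_gap E) i) -> D = E.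
Proof.
move=> DE; apply/setP=> j; have jm := ltn_ord j.
have := DE j.+1; rewrite !gap_sumS DE /short_gap ?inord_val; last by lia.
by move=> /(_ ltac:(lia)); lia.
Qed.

Lemma tokens_to_set_inj D E :
  gap_sum (short_gap D) m.+1 = n + 3 -> gap_sum (short_gap E) m.+1 = n + 3 ->
  tokens_to_set D = tokens_to_set E -> D = E.
Proof.
move=> Dn En DE; apply: eq_short_gap; apply: increasing_same_image.
- by move=> i j /(gap_sum_ltn (short_gap D)); lia.
- by move=> i j /(gap_sum_ltn (short_gap E)); lia.
move=> z; have := padded_gap_set Dn z; have := padded_gap_set En z.
by rewrite -!/(tokens_to_set _) DE /= => -> ->.
Qed.

(** Moving a token from [a] to [a.+1] lengthens gap [a] and shortens the next one. Only the sum at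
    [a.+1] changes, growing by 1, so exactly one vertex slides up. *)
Lemma slide_up_tokens_to_set D E :
  gap_sum (short_gap D) m.+1 = n + 3 -> gap_sum (short_gap E) m.+1 = n + 3 ->
  slide_up D E -> slide_up (tokens_to_set D) (tokens_to_set E).
Proof.
move=> Dn En [a [b [ba [aD bD] [aE bE] DE]]].
have bm := ltn_ord b.
have gapE i : i < m.+2 ->
    gap_sum (short_gap E) i = gap_sum (short_gap D) i + (i == a.+1).
  elim: i => [|i IH] im; first by rewrite !gap_sum0.
  rewrite !gap_sumS IH; last by lia.
  have [->|ia] := eqVneq i a.
    by rewrite /short_gap !inord_val aD (negbTE aE); lia.
  have [->|ib] := eqVneq i b.
    by rewrite /short_gap !inord_val bE (negbTE bD); lia.
  have -> : short_gap E i = short_gap D i.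
    by rewrite /short_gap DE // -(inj_eq val_inj) /= inordK //; lia.
  by lia.
(* Comparison with both ends shows that element [a.+1] is a genuine vertex before and after the
   move. *)
have := @gap_sum_ltn (short_gap D) 0 a.+1 isT; rewrite gap_sum0 => a2.
have := @gap_sum_ltn (short_gap E) a.+1 m.+1; rewrite En => h.
have gE := gapE a.+1; rewrite eqxx in gE.
have xn : gap_sum (short_gap D) a.+1 - 2 < n by lia.
have yn : (gap_sum (short_gap D) a.+1 - 2).+1 < n by lia.
exists (Ordinal xn), (Ordinal yn); split=> //.
- split; first by apply/gap_setP; exists a.+1 => /=; lia.
  apply/gap_setP=> -[i im] /=.
  by case: (gap_sum_cases (short_gap D) i a.+1) => [->|[_]|[_]]; lia.
- split; last by apply/gap_setP; exists a.+1 => /=; lia.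
  apply/gap_setP=> -[i im] /=.
  by case: (gap_sum_cases (short_gap E) i a.+1) => [->|[_]|[_]]; lia.
move=> z; rewrite -!(inj_eq val_inj) /= => zx zy.
apply/gap_setP/gap_setP => -[i im zi]; exists i => //; have := gapE i im;
  have [ia|_] := eqVneq i a.+1; try (subst i); lia.
Qed.

(** If the moved vertex is element [i0], the new enumeration is the old one raised by 1 at [i0]. Its
    differences show a short gap passing from [i0 - 1] to [i0]. *)
Lemma slide_up_of_tokens_to_set D E :
  gap_sum (short_gap D) m.+1 = n + 3 -> gap_sum (short_gap E) m.+1 = n + 3 ->
  slide_up (tokens_to_set D) (tokens_to_set E) -> slide_up D E.
Proof.
move=> Dn En [x [y [yx [xD yD] [xE yE] DE]]].
have xn := ltn_ord x; have yn := ltn_ord y.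
have /gap_setP[i0 im xi] := xD.
have i0_gt0 : i0 != 0 by apply: contraTneq isT => i00; move: xi; rewrite i00 gap_sum0; lia.
have i0_lt : i0 != m.+1 by apply: contraTneq isT => i00; move: xi; rewrite i00 Dn; lia.
have [a ia] : exists a, i0 = a.+1 by exists i0.-1; lia.
have gapE i : i < m.+2 ->
    gap_sum (short_gap E) i = gap_sum (short_gap D) i + (i == i0).
  (* Raising one entry by 1 keeps the enumeration strictly increasing, since gaps are at least 2; it
     remains to compare the padded sets. *)
  move: i; apply: increasing_same_image.
  - by move=> i j /(gap_sum_ltn (short_gap E)); lia.
  - by move=> i j /(gap_sum_ltn (short_gap D)); lia.
  move=> z; rewrite -/(gap_sums (short_gap E) m.+2) -(padded_gap_set En).
  apply/paddedP/mapP => [[->|->|[w wE ->]]|[i]].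
  + by exists 0; rewrite // gap_sum0 eq_sym (negbTE i0_gt0).
  + exists m.+1; first by rewrite mem_iota; lia.
    by rewrite Dn eq_sym (negbTE i0_lt) addn0.
  + have [->|wy] := eqVneq w y.
      by exists i0; rewrite ?mem_iota ?eqxx -?xi ?yx; lia.
    have wx : w != x by apply: contraTneq wE => ->.
    move: wE; rewrite -DE // => /gap_setP[i im' wi].
    exists i; first by rewrite mem_iota; lia.
    rewrite -wi.
    have [ii|_] := eqVneq i i0; last by rewrite addn0.
    by move: wx; rewrite -(inj_eq val_inj) /=; subst i; lia.
  rewrite mem_iota /= => im' ->.
  have [->|ii] := eqVneq i i0.
    by constructor 3; exists y => //; rewrite -xi yx; lia.
  have : padded (tokens_to_set D) (gap_sum (short_gap D) i).
    by rewrite (padded_gap_set Dn); apply/gap_sumsP; exists i.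
  rewrite addn0; case/paddedP=> [->|->|[w wD wi]].
  - by constructor 1.
  - by constructor 2.
  constructor 3; exists w => //; rewrite -DE //.
    apply: contraNneq ii => wx; move: wi; rewrite wx xi => wi.
    by case: (gap_sum_cases (short_gap D) i i0) => [->|[_]|[_]] //; lia.
  by apply: contraTneq wD => ->.
(* Consecutive differences of [gapE]: the gap lengths change only at [a], from 2 to 3, and at [i0],
   from 3 to 2. *)
have short i (im' : i < m.+1) :
    (3 - short_gap E i) + (i == i0) = (3 - short_gap D i) + (i.+1 == i0).
  by have := gapE i.+1 ltac:(lia); rewrite !gap_sumS (gapE i) ?(ltnW im') //; lia.
have am : a < m.+1 by lia.
have im1 : i0 < m.+1 by lia.
have aS := short a am; have iS := short i0 im1.
have inordE i (h : i < m.+1) : inord i = Ordinal h :> 'I_m.+1.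
  by apply: val_inj; rewrite /= inordK.
rewrite /short_gap !(inordE _ am) in aS; rewrite /short_gap !(inordE _ im1) in iS.
have [aD aE] : Ordinal am \in D /\ Ordinal am \notin E.
  by move: aS; do 2 case: (_ \in _); move=> aS; split=> //; lia.
have [bD bE] : Ordinal im1 \notin D /\ Ordinal im1 \in E.
  by move: iS; do 2 case: (_ \in _); move=> iS; split=> //; lia.
exists (Ordinal am), (Ordinal im1); split=> //=.
move=> z; rewrite -!(inj_eq val_inj) /= => za zi.
have := short z (ltn_ord z); rewrite /short_gap inord_val.
by do 2 case: (_ \in _); lia.
Qed.

Lemma token_slide_tokens_to_set D E :
  gap_sum (short_gap D) m.+1 = n + 3 -> gap_sum (short_gap E) m.+1 = n + 3 ->
  token_slide (tokens_to_set D) (tokens_to_set E) =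
  @token_slide (path_graph m.+1) D E.
Proof.
move=> Dn En; apply/token_slide_path/token_slide_path => -[] h; [left|right|left|right].
- exact: slide_up_of_tokens_to_set h.
- exact: slide_up_of_tokens_to_set h.
- exact: slide_up_tokens_to_set h.
- exact: slide_up_tokens_to_set h.
Qed.

End GapTokens.

(** * The independent domination number of a path, and its i-graph *)

(** The [#|X| + 1] gaps, each at most 3, add up to [n + 3]. *)
Lemma card_indep_dominating_path n (X : {set path_graph n}) :
  indep_dominating X -> n <= 3 * #|X|.
Proof.
case/indep_dominating_gap_set=> P [m [Pn3 ->]]; rewrite card_gap_set //.
by have := gap_sum_total P m.+1; lia.
Qed.

Lemma indep_dom_number_path n m r : n + r = 3 * m -> r <= 2 -> 0 < n ->
  indep_dom_number (path_graph n) = m.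
Proof.
move=> nrm r2 n0; rewrite /indep_dom_number; case: ex_minnP => i.
case/existsP=> X /andP[/card_indep_dominating_path nX /eqP Xi] min_i.
suff im : i <= m by lia.
(* All [r] short gaps come first; they fit among the [m.+1] gaps because [0 < n] forces [m >= 1]. *)
pose P j := j < r.
have Pn3 : gap_sum P m.+1 = n + 3.
  have sumP M : \sum_(j < M) P j = minn r M.
    by elim: M => [|M IH]; rewrite ?big_ord0 ?big_ord_recr /= ?IH /P; lia.
  by have := gap_sum_total P m.+1; rewrite sumP; lia.
apply: min_i; apply/existsP; exists (gap_set n P m).
by rewrite gap_set_indep_dominating // card_gap_set ?eqxx.
Qed.

Lemma igraph_path n m r : n + r = 3 * m -> r <= 2 -> 0 < n ->
  igraph (path_graph n) ≅ token_graph (path_graph m.+1) r.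
Proof.
move=> nrm r2 n0; have num := indep_dom_number_path nrm r2 n0.
apply: graph_iso_sym.
have Dn3 (D : token_graph (path_graph m.+1) r) :
    gap_sum (short_gap (val D)) m.+1 = n + 3.
  by have := gap_sum_card (val D); rewrite (eqP (valP D)); lia.
have isetD (D : token_graph (path_graph m.+1) r) : is_iset (tokens_to_set n (val D)).
  apply/andP; split; first exact: gap_set_indep_dominating.
  by rewrite num; apply/eqP; apply: card_gap_set.
pose f D : igraph (path_graph n) :=
  exist (fun X : {set path_graph n} => is_iset X) _ (isetD D).
exists f; last by move=> D E; apply: token_slide_tokens_to_set.
apply: inj_surj_bij => [D E /(congr1 val) DE|[X Xi]].
  by apply: val_inj; apply: tokens_to_set_inj DE.
have /andP[/indep_dominating_gap_set[P [m' [Pn3 XE]]] /eqP] := Xi.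
(* Counting vertices identifies the number [m'] from the gap description with [m], so the values of
   [P] below [m.+1] can be stored as the token set [D]. *)
rewrite num => Xm; have mm := card_gap_set Pn3; rewrite -XE Xm in mm; rewrite -{m'}mm in Pn3 XE.
pose D : {set 'I_m.+1} := [set j : 'I_m.+1 | P j].
have gapD i : i < m.+2 -> gap_sum (short_gap D) i = gap_sum P i.
  move=> im; apply: (@eq_gap_sum _ _ m.+1) => // j jm.
  by rewrite /short_gap inE inordK.
have cardD : #|D| == r.
  by have := gap_sum_card D; rewrite gapD // Pn3; lia.
exists (exist _ D cardD); apply: val_inj; rewrite /= XE.
by apply/setP=> x; apply/gap_setP/gap_setP => -[i im xi]; exists i; rewrite // xi gapD.
Qed.

Theorem mainTheorem1 (n k : nat) (n_ge1 : 1 <= n) :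
  [/\ n = 3 * k -> igraph (path_graph n) ≅ complete_graph 1,
      n = 3 * k + 1 -> igraph (path_graph n) ≅ worn_lattice k
    & n = 3 * k + 2 -> igraph (path_graph n) ≅ path_graph (k + 2)].
Proof.
split=> nk.
(* In each case [m] is [n / 3] rounded up and [r = 3 * m - n], which gives 0, 2 and 1 tokens in
   turn. *)
- apply: graph_iso_trans (token_graph0 _).
  by apply: (@igraph_path n k 0); lia.
- apply: graph_iso_trans (token_graph2_path k).
  by apply: (@igraph_path n k.+1 2); lia.
rewrite addn2; apply: graph_iso_trans (token_graph1 _).
by apply: (@igraph_path n k.+1 1); lia.
Qed.
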